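(* Let $p$ be an odd prime for which $2$ is a semiprimitive root. Then the exact exponent $\alpha=\alpha(p)$ in the remainder term of the formula $T^{(j)}_{p,a}(x)=\frac{x}{2p}+O(x^{\lambda})$, where $\lambda=\frac{\ln 3}{\ln 4}$, $a\in\{0,1,\ldots,p-1\}$ and $j\in\{0,1\}$, is $$\alpha=\frac{\ln p}{(p-1)\ln 2}.$$
   Context: For an odd prime $p$, $2$ is called a semiprimitive root modulo $p$ if $2$ has multiplicative order $\frac{p-1}{2}$ modulo $p$ and the congruence $2^x\equiv -1 \pmod p$ has no solution in integers $x\ge 0$. For a nonnegative integer $n$, $s(n)$ denotes the number of $1$'s in the binary expansion of $n$. For an integer $m>1$, an integer $a\in[0,m-1]$ and $j\in\{0,1\}$, put $$T^{(j)}_{m,a}(x)=\#\{n\in\mathbb{Z}: 0\le n<x,\ n\equiv a \pmod m,\ s(n)\equiv j \pmod 2\}.$$ The exact exponent in the remainder term is the number $\alpha=\alpha(m)$ such that for every $\varepsilon>0$, as $x\to\infty$, $$T^{(j)}_{m,a}(x)=\frac{x}{2m}+O(x^{\alpha+\varepsilon})\quad\text{and}\quad T^{(j)}_{m,a}(x)=\frac{x}{2m}+\Omega(x^{\alpha-\varepsilon}),$$ for $a\in\{0,\ldots,m-1\}$ and $j\in\{0,1\}$ (the same $\alpha$, depending only on $m$, serves for all such $a$ and $j$). Here $f(x)=\Omega(g(x))$ with $g>0$ has the usual analytic number theory meaning that $f(x)\ne o(g(x))$, i.e. $\limsup_{x\to\infty}|f(x)|/g(x)>0$. *)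

(* Defs.v *)
From HB Require Import structures.
From mathcomp Require Import all_boot all_order all_algebra finmap.
From mathcomp Require Import all_classical all_reals all_analysis.
Import Order.TTheory GRing.Theory Num.Theory.
Import numFieldNormedType.Exports.

Set Implicit Arguments.
Unset Strict Implicit.
Unset Printing Implicit Defensive.

Local Open Scope classical_set_scope.
Local Open Scope ring_scope.

(* A [d.-primitive_root] is an element of multiplicative order d.  Meant for
   odd primes p only: ['F_p] is Z/pZ only if p is prime, and [p.-1./2] is
   (p-1)/2 only if p is odd. *)
Definition semiprimitive_root2 (p : nat) : Prop :=
  (p.-1./2).-primitive_root (2%:R : 'F_p) /\
  (forall x : nat, (2%:R : 'F_p) ^+ x <> -1).

(* [n %/ 2 ^ i] is odd iff the binary digit of weight 2^i of n is 1; digits of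
   index i >= n vanish since n < 2^n. *)
Definition binary_ones (n : nat) : nat := (\sum_(i < n) odd (n %/ 2 ^ i))%N.

Definition digit_parity_set (R : realType) (m a j : nat) (x : R) : set nat :=
  [set n : nat | [/\ n%:R < x, (n = a %[mod m])%N
    & (binary_ones n = j %[mod 2])%N]].

(* [fset_set] returns the empty set on infinite sets; by this lemma that does
   not happen in [digit_parity_count]. *)
Lemma digit_parity_set_finite (R : realType) (m a j : nat) (x : R) :
  finite_set (digit_parity_set m a j x).
Proof.
apply: (@sub_finite_set _ _ `I_(Num.bound `|x|)); last exact: finite_II.
move=> n [nx _ _] /=; rewrite -(ltr_nat R); apply: (lt_le_trans nx).
by rewrite (le_trans (ler_norm x))// ltW// archi_boundP.
Qed.

Definition digit_parity_count (R : realType) (m a j : nat) (x : R) : nat :=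
  #|` fset_set (digit_parity_set m a j x)|%fset.

Definition remainder (R : realType) (m a j : nat) (x : R) : R :=
  (digit_parity_count m a j x)%:R - x / (2 * m%:R).

(* Lets the Landau notations be used at +oo. *)
Canonical pinfty_nbhs_filter_on (R : numFieldType) :=
  FilterType (pinfty_nbhs R) (@proper_pinfty_nbhs R).

(* The Omega-estimate is the negation of little-o, as usual in analytic number
   theory; the Omega of the [landau] library is a stronger relation. *)
Definition is_exact_exponent (R : realType) (m : nat) (alpha : R) : Prop :=
  forall eps : R, 0 < eps ->
  forall a j : nat, (a < m)%N -> (j < 2)%N ->
    (remainder m a j =O_ (+oo_R) (fun x : R => x `^ (alpha + eps))) /\
    ~ (remainder m a j =o_ (+oo_R) (fun x : R => x `^ (alpha - eps))).

(* Main.v *)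
Require Import Defs.
From HB Require Import structures.
From mathcomp Require Import all_boot all_order all_algebra finmap all_field.
From mathcomp Require Import all_classical all_reals all_analysis.
From mathcomp Require Import zify ring lra.
Import Order.TTheory GRing.Theory Num.Theory.
Import numFieldNormedType.Exports.
Set Implicit Arguments.
Unset Strict Implicit.
Local Open Scope classical_set_scope.
Local Open Scope ring_scope.

(** Write [t n] = (-1)^{s(n)} for the Thue-Morse sign and, for a residue [u]
modulo [p], let S_u(N) be the sum of [t n] over [n < N] with [n = u] mod [p].
Since the classes of [a] in [0, N) have N/p + O(1) elements, the remainder is
(-1)^j S_a(N)/2 + O(1) with N = ceil(x) ([remainder_thue_morse_sum]), so only
the growth of S_a matters.

The heart of the matter is an exact recurrence ([thue_morse_sum_rec]): with
M = 2^(p-1),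
   S_u(m M) = (t 0 + ... + t (m-1)) - p S_u(m),
where the first term is -1, 0 or 1.  As M = 1 mod [p] and [t] is multiplicative
across blocks of binary digits, the recurrence amounts to the values
S_u(M) = 1 for [u != 0] and S_0(M) = 1 - p ([thue_morse_sum_period]).  By
Fourier inversion on Z/p these values say that, for every primitive [p]-th root
of unity z, the product of the factors 1 - z^(2^i), i < p-1, equals -p.

This product is P^2, where P is the product of 1 - z^h over the subgroup H
generated by 2, because 2 has order (p-1)/2.  As -1 is not in H, the nonzero
residues are the disjoint union of H and -H, so that P P' = p, where P' is the
product of 1 - z^(-h).  Finally 1 - z^(-h) = - z^(-h) (1 - z^h), the order of H
is odd (otherwise -1 would be a power of 2) and the elements of H add up to
2^((p-1)/2) - 1 = 0, so P' = -P and P^2 = -p ([semiprimitive_prod_sqr]).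

Let alpha be determined by M^alpha = p, which is the exponent of the theorem.
Iterating the recurrence along the base-M digits of N gives |S_u(N)| <= C N^alpha
([thue_morse_sum_upper_bound]), and along the powers of M it gives
|S_u(M^(t+1))| >= p^t ([thue_morse_sum_lower_bound]) for every residue [u].  So
alpha is an exact exponent; an exact exponent is unique, and alpha <= ln 3 / ln 4
because p^2 <= 3^(p-1). *)

(** * The Thue-Morse sign and its generating product *)

Lemma binary_ones_extend (n N : nat) : (n <= N)%N ->
  binary_ones n = (\sum_(i < N) odd (n %/ 2 ^ i))%N.
Proof.
move=> nN; rewrite /binary_ones -!(big_mkord xpredT (fun i => odd (n %/ 2 ^ i) : nat)).
rewrite (big_cat_nat _ (n := n) (p := N)) //= [X in _ = (_ + X)%N]big1_seq ?addn0 //.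
move=> i /=; rewrite mem_index_iota => /andP[ni _].
by rewrite divn_small // (leq_ltn_trans ni) // ltn_expl.
Qed.

(** The upper bound of the sum that defines [binary_ones] depends on the number
itself; extending both sums beyond it makes them comparable by a shift. *)
Lemma binary_onesD (b n : nat) : (b < 2)%N ->
  binary_ones (n * 2 + b) = (binary_ones n + b)%N.
Proof.
move=> b2; rewrite (@binary_ones_extend _ (n * 2 + b).+1) //.
rewrite (@binary_ones_extend n (n * 2 + b)); last by lia.
rewrite big_ord_recl expn0 divn1 addnC; congr addn.
  by apply: eq_bigr => i _; rewrite lift0 expnS divnMA divnMDl // (divn_small b2) addn0.
by rewrite oddD oddM andbF /=; case: b b2 => [|[]].
Qed.

Definition thue_morse (n : nat) : int := (-1) ^+ binary_ones n.

Lemma thue_morse0 : thue_morse 0 = 1.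
Proof. by rewrite /thue_morse /binary_ones big_ord0. Qed.

Lemma thue_morse_double (n : nat) : thue_morse (n * 2) = thue_morse n.
Proof. by rewrite /thue_morse -[X in binary_ones X]addn0 binary_onesD // addn0. Qed.

Lemma thue_morse_doubleS (n : nat) : thue_morse (n * 2).+1 = - thue_morse n.
Proof. by rewrite /thue_morse -addn1 binary_onesD // exprD expr1 mulrN1. Qed.

(** The binary digits of [q * 2 ^ L + r] are those of [q] followed by those of
[r], so the digit sums add. *)
Lemma thue_morse_blockM (L q r : nat) : (r < 2 ^ L)%N ->
  thue_morse (q * 2 ^ L + r) = thue_morse q * thue_morse r.
Proof.
elim: L q r => [|L IH] q r.
  by rewrite ltnS leqn0 => /eqP->; rewrite thue_morse0 mulr1 muln1 addn0.
rewrite expnS => rL.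
have r2 : (r %/ 2 < 2 ^ L)%N by rewrite ltn_divLR // mulnC.
have Er := divn_eq r 2; have b2 := ltn_pmod r (isT : 0 < 2)%N.
rewrite Er mulnCA (mulnC 2 (q * _)%N) addnA -mulnDl.
case: (r %% 2)%N b2 => [|[|//]] _.
  by rewrite !addn0 !thue_morse_double IH.
by rewrite !addn1 !thue_morse_doubleS IH // mulrN.
Qed.

(** Expanding the product, each [n < 2 ^ L] arises once, from the factors at
which its binary digit is 1, with one sign change for each of them. *)
Lemma thue_morse_generating (K : comNzRingType) (L : nat) (z : K) :
  \sum_(0 <= n < 2 ^ L) (thue_morse n)%:~R * z ^+ n =
  \prod_(i < L) (1 - z ^+ (2 ^ i)).
Proof.
elim: L z => [|L IH] z.
  by rewrite big_nat1 big_ord0 thue_morse0 expr0 mulr1.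
rewrite expnS mulnC big_nat_mul big_ord_recl expn0 expr1.
rewrite [X in _ * X](eq_bigr (fun i : 'I_L => 1 - (z ^+ 2) ^+ (2 ^ i))); last first.
  by move=> i _; rewrite lift0 expnS exprM.
rewrite -IH mulr_sumr; apply: eq_bigr => i _.
rewrite mulSn addnC addn2 big_ltn // big_nat1 thue_morse_double thue_morse_doubleS.
by rewrite mulrNz exprS (mulnC i) exprM mulrBl mul1r mulNr mulrCA.
Qed.

(** * The product over the subgroup generated by 2 *)

(** This is the value at 1 of ('X^n - 1) / ('X - 1). *)
Lemma prod_1_sub_prim_root (K : fieldType) (n : nat) (z : K) :
  (0 < n)%N -> n.-primitive_root z -> \prod_(1 <= i < n) (1 - z ^+ i) = n%:R.
Proof.
move=> n0 zp; have := factor_Xn_sub_1 zp.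
rewrite big_ltn // expr0 subrX1 => /(mulfI (negbT (polyXsubC_eq0 1))).
move=> /(congr1 (fun q => q.[1])); rewrite horner_prod horner_sum.
under eq_bigr => i _ do rewrite hornerXsubC.
move=> ->; under eq_bigr => i _ do rewrite hornerXn expr1n.
by rewrite sumr_const card_ord.
Qed.

Lemma prod_1_sub_prim_root_Fp (K : fieldType) (p : nat) (z : K) :
  prime p -> p.-primitive_root z ->
  \prod_(u : 'F_p | u != 0) (1 - z ^+ u) = p%:R.
Proof.
move=> pp zp; rewrite -(prod_1_sub_prim_root (prime_gt0 pp) zp).
rewrite -(big_mkord (fun i => i != 0%N) (fun i => 1 - z ^+ i)) Fp_cast //.
rewrite big_ltn_cond ?prime_gt0 //= big_nat_cond [RHS]big_nat_cond.
by apply: eq_bigl => i; case: i.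
Qed.

Lemma expr_val_Fp (K : nzRingType) (p : nat) (z : K) (n : nat) :
  prime p -> p.-primitive_root z -> z ^+ (n%:R : 'F_p) = z ^+ n.
Proof. by move=> pp zp; rewrite val_Fp_nat // prim_expr_mod. Qed.

Lemma expr_val_FpD (K : nzRingType) (p : nat) (z : K) (u v : 'F_p) :
  prime p -> p.-primitive_root z -> z ^+ (u + v)%R = z ^+ u * z ^+ v.
Proof.
by move=> pp zp; rewrite -{1}(natr_Zp u) -{1}(natr_Zp v) -natrD expr_val_Fp // exprD.
Qed.

(** Otherwise the element of order 2 in the group generated by 2, which is -1,
would be a power of 2. *)
Lemma semiprimitive_half_odd (p : nat) : semiprimitive_root2 p -> odd p.-1./2.
Proof.
case=> d2 Nm1; have d0 := prim_order_gt0 d2; apply/negPn/negP => dev.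
set d := p.-1./2 in d2 d0 dev; have Ed : d = (d./2 * 2)%N by lia.
have := prim_expr_order d2; rewrite Ed exprM => /eqP; rewrite sqrf_eq1.
case/orP => [/eqP h1|/eqP/Nm1 //].
by have := prim_order_dvd d2 d./2; rewrite h1 eqxx => /dvdn_leq; lia.
Qed.

(** The powers of 2 and their opposites are (p-1)/2 + (p-1)/2 distinct nonzero
residues, hence all of them: a coincidence 2^i = - 2^j would make -1 a power
of 2. *)
Lemma prod_semiprimitive_units (p : nat) (G : 'F_p -> algC) :
  prime p -> odd p -> semiprimitive_root2 p ->
  \prod_(u : 'F_p | u != 0) G u =
  \prod_(i < p.-1./2) G (2%:R ^+ i) * \prod_(i < p.-1./2) G (- 2%:R ^+ i).
Proof.
move=> pp op [d2 Nm1]; set d := p.-1./2 in d2 *.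
pose s := [seq (2%:R : 'F_p) ^+ i | i <- iota 0 d].
pose s' := [seq - (2%:R : 'F_p) ^+ i | i <- iota 0 d].
have two0 : (2%:R : 'F_p) != 0.
  apply/eqP => h; have := prim_expr_order d2; rewrite h expr0n.
  by have := prim_order_gt0 d2; case: (d) => // k _ /esym/eqP; rewrite oner_eq0.
have us : uniq s.
  rewrite map_inj_in_uniq ?iota_uniq // => i j; rewrite !mem_iota !add0n /= => iD jD.
  by move/eqP; rewrite (eq_prim_root_expr d2) !modn_small // => /eqP.
have us' : uniq s' by rewrite /s' map_comp map_inj_uniq //; exact: oppr_inj.
have u_cat : uniq (s ++ s').
  rewrite cat_uniq us us' andbT /=; apply/hasPn => _ /mapP[j jd ->].
  apply/negP => /mapP[i _ h]; apply: (Nm1 (i + (d - j))%N).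
  rewrite exprD -h mulNr -exprD subnKC ?prim_expr_order //.
  by move: jd; rewrite mem_iota add0n => /andP[_ /ltnW].
have e_cat : s ++ s' =i predC1 (0 : 'F_p).
  have sub : {subset s ++ s' <= enum (predC1 (0 : 'F_p))}.
    move=> u; rewrite mem_enum mem_cat inE => /orP[] /mapP[i _ ->].
      by rewrite expf_neq0.
    by rewrite oppr_eq0 expf_neq0.
  have [|_ e] := uniq_min_size u_cat sub; last by move=> u; rewrite e mem_enum.
  rewrite -cardE cardC1 card_Fp // size_cat !size_map !size_iota.
  by have := prime_gt0 pp; lia.
rewrite -!(big_mkord xpredT (fun i => G (_ ^+ i))).
rewrite -(big_mkord xpredT (fun i => G (- _ ^+ i))) /index_iota subn0.
rewrite -(big_map _ xpredT G) 
  -[X in _ * X](big_map (fun i => - (2%:R : 'F_p) ^+ i) xpredT G).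
rewrite -big_cat /= (big_uniq _ u_cat).
by apply: eq_bigl => u; rewrite e_cat.
Qed.

(** The conjugate product P' satisfies both [P * P' = p] and [P' = - P]; the
latter needs the number of factors to be odd and the exponents to add up to 0
modulo [p]. *)
Lemma semiprimitive_prod_sqr (p : nat) (z : algC) :
  prime p -> odd p -> semiprimitive_root2 p -> p.-primitive_root z ->
  (\prod_(i < p.-1./2) (1 - z ^+ (2 ^ i))) ^+ 2 = - p%:R.
Proof.
move=> pp op sp zp; set d := p.-1./2.
set P := \prod_(i < d) _; have [d2 _] := sp; rewrite -/d in d2.
pose P' := \prod_(i < d) (1 - z ^+ (- 2%:R ^+ i : 'F_p)%R).
have eP : \prod_(i < d) (1 - z ^+ (2%:R ^+ i : 'F_p)%R) = P.
  by apply: eq_bigr => i _; rewrite -natrX expr_val_Fp.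
have PP' : P * P' = p%:R.
  rewrite -(prod_1_sub_prim_root_Fp pp zp).
  by rewrite (prod_semiprimitive_units (fun u => 1 - z ^+ u)) // -/d eP.
have e1 : \prod_(i < d) z ^+ (2 ^ i) = 1.
  rewrite prodrXr; have := predn_exp 2 d; rewrite mul1n => <-.
  have z0 : z != 0.
    apply: contraTneq (prim_order_gt0 zp) => z0; have := prim_expr_order zp.
    by rewrite z0 expr0n; case: (p) => // k /esym/eqP; rewrite oner_eq0.
  apply: (mulIf z0); rewrite mul1r -exprSr prednK ?expn_gt0 //.
  by rewrite -[RHS]expr1 -(expr_val_Fp (2 ^ d) pp zp) -(expr_val_Fp 1 pp zp)
    natrX (prim_expr_order d2).
have P'P : P' = - P.
  have term (i : 'I_d) : (1 - z ^+ (- 2%:R ^+ i : 'F_p)%R) * z ^+ (2 ^ i) =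
      - 1 * (1 - z ^+ (2 ^ i)).
    rewrite mulrBl mul1r -{2}(expr_val_Fp _ pp zp) natrX -expr_val_FpD //.
    by rewrite addNr expr0 mulN1r opprB.
  have m1 : \prod_(i < d) (-1 : algC) = -1.
    by rewrite prodr_const card_ord -signr_odd (semiprimitive_half_odd sp) expr1.
  rewrite -[LHS]mulr1 -e1 -[RHS]mulN1r -m1 -!big_split.
  by apply: eq_bigr => i _; exact: term.
by rewrite expr2 -[X in _ * X]opprK -P'P mulrN PP'.
Qed.

Lemma semiprimitive_full_prod (p : nat) (z : algC) :
  prime p -> odd p -> semiprimitive_root2 p -> p.-primitive_root z ->
  \prod_(i < p.-1) (1 - z ^+ (2 ^ i)) = - p%:R.
Proof.
move=> pp op sp zp; rewrite -(semiprimitive_prod_sqr pp op sp zp).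
have [d2 _] := sp; set d := p.-1./2 in d2 *.
have -> : (p.-1 = d + d)%N by have := prime_gt0 pp; lia.
rewrite big_split_ord expr2 /=; congr (_ * _); apply: eq_bigr => i _.
rewrite -(expr_val_Fp (2 ^ (_ + _)) pp zp) natrX exprD (prim_expr_order d2) mul1r.
by rewrite -natrX expr_val_Fp.
Qed.

(** * Thue-Morse sums in residue classes *)

Definition thue_morse_sum (p : nat) (u : 'F_p) (N : nat) : int :=
  \sum_(0 <= n < N | n%:R == u) thue_morse n.

Lemma fourier_thue_morse_sum (p : nat) (z : algC) (N : nat) :
  prime p -> z ^+ p = 1 ->
  \sum_(0 <= n < N) (thue_morse n)%:~R * z ^+ n =
  \sum_(u : 'F_p) (thue_morse_sum u N)%:~R * z ^+ u.
Proof.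
move=> pp z1; under [RHS]eq_bigr => u _.
  rewrite /thue_morse_sum rmorph_sum mulr_suml /= big_mkcond /=.
  over.
rewrite exchange_big /=; apply: eq_bigr => n _.
rewrite (bigD1 (n%:R : 'F_p)) //= eqxx big1 ?addr0.
  by rewrite val_Fp_nat // expr_mod.
by move=> u; rewrite eq_sym => /negbTE->.
Qed.

(** Both sides have the same Fourier transform on Z/p: at the trivial character
the generating product and 1 * p - p both vanish, and at a primitive root [z]
the product is -p while the powers of [z] add up to 0.  Inversion takes the
form that a polynomial of degree less than [p] vanishing at all [p]-th roots of
unity is zero. *)
Lemma thue_morse_sum_period (p : nat) (u : 'F_p) :
  prime p -> odd p -> semiprimitive_root2 p ->
  thue_morse_sum u (2 ^ p.-1) = 1 - (if u == 0 then p%:R else 0).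
Proof.
move=> pp op sp; have p0 := prime_gt0 pp.
have [z zp] := C_prim_root_exists p0.
pose c (u : 'F_p) : int := thue_morse_sum u (2 ^ p.-1) - (1 - (if u == 0 then p%:R else 0)).
pose Q : {poly algC} := \poly_(i < p) (c i%:R)%:~R.
suff Q0 : Q = 0.
  have := coef_poly p (fun i => (c i%:R)%:~R : algC) u.
  rewrite -/Q Q0 coef0 -{2}(Fp_cast pp) ltn_ord natr_Zp => /esym/eqP.
  by rewrite intr_eq0 subr_eq0 => /eqP.
pose rs := [seq z ^+ i | i <- iota 0 p].
apply: (@roots_geq_poly_eq0 _ Q rs); last by rewrite size_map size_iota size_poly.
  apply/allP => w /mapP[k kp ->]; set w' := z ^+ k.
  have w1 : w' ^+ p = 1 by rewrite -exprM mulnC exprM (prim_expr_order zp) expr1n.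
  have -> : root Q w' = (\sum_(u : 'F_p) (c u)%:~R * w' ^+ u == 0).
    rewrite rootE horner_poly -(big_mkord xpredT (fun i => (c i%:R)%:~R * w' ^+ i)).
    rewrite -{1}(Fp_cast pp) big_mkord; congr (_ == _).
    by apply: eq_bigr => v _; rewrite natr_Zp.
  have -> : \sum_(u : 'F_p) (c u)%:~R * w' ^+ u =
    \prod_(i < p.-1) (1 - w' ^+ (2 ^ i)) - \sum_(u : 'F_p) w' ^+ u + p%:R.
    rewrite -thue_morse_generating (fourier_thue_morse_sum _ pp w1).
    rewrite -sumrB (bigD1 (0 : 'F_p)) //= [in RHS](bigD1 (0 : 'F_p)) //=.
    rewrite addrAC; congr (_ + _).
      by rewrite /c eqxx !expr0 !mulr1 !rmorphB rmorph1 rmorph_nat opprB addrCA addrC.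
    by apply: eq_bigr => v v0; rewrite /c (negbTE v0) subr0 rmorphB rmorph1 mulrBl mul1r.
  have sumE : \sum_(u : 'F_p) w' ^+ u = \sum_(i < p) w' ^+ i.
    rewrite -(big_mkord xpredT (fun i => w' ^+ i)) Fp_cast //.
    by rewrite big_mkord.
  rewrite sumE; have [k0|k0] := posnP k.
    rewrite /w' k0 expr0; under [X in _ - X]eq_bigr do rewrite expr1n.
    rewrite sumr_const card_ord subrK.
    have p1 : (0 < p.-1)%N by have := prime_gt1 pp; lia.
    by rewrite (bigD1 (Ordinal p1)) //= expr1n subrr mul0r.
  have wp : p.-primitive_root w'.
    rewrite prim_root_exp_coprime // coprime_sym prime_coprime //.
    by apply/negP => /(dvdn_leq k0); move: kp; rewrite mem_iota; lia.
  rewrite (semiprimitive_full_prod pp op sp wp).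
  suff -> : \sum_(i < p) w' ^+ i = 0 by rewrite subr0 addNr.
  apply: (@mulfI _ (w' - 1)); last by rewrite mulr0 -subrX1 w1 subrr.
  rewrite subr_eq0 -(prim_expr_order zp) (eq_prim_root_expr zp) modnn.
  by move: kp; rewrite mem_iota add0n /= => kp; rewrite modn_small // -lt0n.
rewrite map_inj_in_uniq ?iota_uniq // => i j; rewrite !mem_iota !add0n /= => iD jD.
by move/eqP; rewrite (eq_prim_root_expr zp) !modn_small // => /eqP.
Qed.

(** Cut [0, m M), M = 2^(p-1), into blocks of length M.  As M = 1 mod [p], block
number [q] contributes [thue_morse q] times the sum over a full period in the
class [u - q], whose value is exceptional only for [q = u]. *)
Lemma thue_morse_sum_rec (p : nat) (u : 'F_p) (m : nat) :
  prime p -> odd p -> semiprimitive_root2 p ->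
  thue_morse_sum u (m * 2 ^ p.-1) =
  \sum_(0 <= n < m) thue_morse n - p%:R * thue_morse_sum u m.
Proof.
move=> pp op sp; have [d2 _] := sp.
have M1 : ((2 ^ p.-1)%:R : 'F_p) = 1.
  have -> : (p.-1 = p.-1./2 * 2)%N by have := prime_gt0 pp; lia.
  by rewrite natrX exprM (prim_expr_order d2) expr1n.
rewrite {1}/thue_morse_sum big_mkcond big_nat_mul.
under eq_bigr => q _.
  rewrite mulSn -{1}[(q * _)%N]add0n big_addn addnK.
  have -> : \sum_(0 <= i < 2 ^ p.-1) (if (i + q * 2 ^ p.-1)%:R == u then
      thue_morse (i + q * 2 ^ p.-1) else 0) =
      thue_morse q * thue_morse_sum (u - q%:R) (2 ^ p.-1).
    rewrite /thue_morse_sum [X in _ * X]big_mkcond mulr_sumr; apply: eq_big_nat => r /andP[_ rM].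
    rewrite natrD natrM M1 mulr1 [_ == _ - _]eq_sym subr_eq eq_sym addnC thue_morse_blockM //.
    by case: ifP => _; rewrite ?mulr0.
  rewrite thue_morse_sum_period // subr_eq0 mulrBr mulr1.
  over.
rewrite sumrB; congr (_ - _); rewrite /thue_morse_sum [in RHS]big_mkcond mulr_sumr.
by apply: eq_bigr => q _; rewrite eq_sym; case: ifP; rewrite ?mulr0 // mulrC.
Qed.

Lemma norm_thue_morse (n : nat) : `|thue_morse n| = 1.
Proof. by rewrite /thue_morse normrX normrN1 expr1n. Qed.

Lemma thue_morse_total_double (m : nat) : \sum_(0 <= n < m * 2) thue_morse n = 0.
Proof.
rewrite big_nat_mul big1_seq // => q _.
by rewrite mulSn add2n big_ltn // big_nat1 thue_morse_double thue_morse_doubleS /= subrr.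
Qed.

Lemma thue_morse_total_bound (m : nat) : `|\sum_(0 <= n < m) thue_morse n| <= 1.
Proof.
rewrite -(odd_double_half m) -muln2; case: (odd m); last first.
  by rewrite add0n thue_morse_total_double normr0.
by rewrite add1n big_nat_recr //= thue_morse_total_double add0r norm_thue_morse.
Qed.

(** * Growth of the Thue-Morse sums *)

Lemma thue_morse_sum_lipschitz (p : nat) (u : 'F_p) (m r : nat) :
  `|thue_morse_sum u (m + r) - thue_morse_sum u m| <= r%:R.
Proof.
rewrite /thue_morse_sum (@big_cat_nat _ _ _ m 0 (m + r)) ?leq_addr //= addrAC subrr add0r.
apply: le_trans (ler_norm_sum _ _ _) _.
under eq_bigr do rewrite norm_thue_morse.
rewrite big_mkcond /= -[leRHS]mulr1n -[X in _ <= X%:R]addn0.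
apply: (@le_trans _ _ (\sum_(m <= i < m + r) 1)).
  by apply: ler_sum => i _; case: ifP.
by rewrite sumr_const_nat addKn addn0.
Qed.

Lemma thue_morse_sum0 (p : nat) (u : 'F_p) : thue_morse_sum u 0 = 0.
Proof. by rewrite /thue_morse_sum big_nil. Qed.

Lemma thue_morse_sum_trivial_bound (p : nat) (u : 'F_p) (m : nat) :
  `|thue_morse_sum u m| <= m%:R.
Proof. by have := thue_morse_sum_lipschitz u 0 m; rewrite thue_morse_sum0 subr0. Qed.

(** At the positive powers of 2 the total sum of signs is 0, so the recurrence
multiplies the absolute value by exactly [p] at each step. *)
Lemma thue_morse_sum_lower_bound (p : nat) (u : 'F_p) (t : nat) :
  prime p -> odd p -> semiprimitive_root2 p ->
  p%:R ^+ t <= `|thue_morse_sum u ((2 ^ p.-1) ^ t.+1)|.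
Proof.
move=> pp op sp; have p1 := prime_gt1 pp.
elim: t => [|t IH].
  rewrite expr0 expn1 thue_morse_sum_period //.
  by case: ifP => _; rewrite ?subr0 ?normr1 //; lia.
rewrite expnSr thue_morse_sum_rec //.
have -> : ((2 ^ p.-1) ^ t.+1 = (2 ^ (p.-1 * t.+1).-1) * 2)%N.
  by rewrite -expnSr prednK ?expnM // muln_gt0; lia.
rewrite thue_morse_total_double sub0r normrN normrM normr_nat exprS.
rewrite -expnSr prednK ?expnM; last by rewrite muln_gt0; lia.
by rewrite ler_pM2l // ltr0n; lia.
Qed.

(** Writing N = m M + r with r < M, the recurrence gives
|S(N)| <= p |S(m)| + 1 + M.  Adding the constant D = M + 1 on the left makes the
claim inductive: p (|S(m)| + D) absorbs the error since p >= 2. *)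
Lemma thue_morse_sum_upper_bound (R : realType) (p : nat) (alpha : R)
    (u : 'F_p) (N : nat) :
  prime p -> odd p -> semiprimitive_root2 p ->
  0 <= alpha -> (2 ^ p.-1)%:R `^ alpha = p%:R -> (0 < N)%N ->
  `|(thue_morse_sum u N)%:~R| + (2 ^ p.-1).+1%:R
    <= 2 * (2 ^ p.-1).+1%:R * N%:R `^ alpha.
Proof.
move=> pp op sp a0 ap; set M := (2 ^ p.-1)%N in ap *.
have p1 := prime_gt1 pp; have M0 : (0 < M)%N by rewrite expn_gt0.
have M2 : (1 < M)%N by rewrite -(expn0 2) ltn_exp2l //; lia.
elim/ltn_ind: N => N IH N0.
have [NM|MN] := ltnP N M.
  have h1 : `|(thue_morse_sum u N)%:~R| <= M.+1%:R :> R.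
    have := thue_morse_sum_trivial_bound u N; rewrite -(ler_int R) intr_norm rmorph_nat => h.
    by apply: (le_trans h); rewrite ler_nat ltnW // ltnS ltnW.
  have h2 : 1 <= N%:R `^ alpha.
    have N1 : 1 <= N%:R :> R by rewrite ler1n.
    by have := ler_powR N1 a0; rewrite powRr0.
  have := ler_wpM2l (ler0n R M.+1) h2; lra.
set m := (N %/ M)%N; have EN : (N = m * M + N %% M)%N := divn_eq N M.
set r := (N %% M)%N in EN; have rM : (r < M)%N := ltn_pmod N M0.
have m0 : (0 < m)%N by rewrite divn_gt0.
have mN : (m < N)%N by rewrite ltn_Pdiv.
have {IH} := IH m mN m0.
have hrec : `|thue_morse_sum u N| <= 1 + p%:R * `|thue_morse_sum u m| + M%:R.
  have h1 := thue_morse_sum_lipschitz u (m * M) r; rewrite -EN in h1.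
  have h2 := thue_morse_sum_rec u m pp op sp; rewrite -/M in h2.
  have h3 := thue_morse_total_bound m.
  have h4 : `|p%:R * thue_morse_sum u m| = p%:R * `|thue_morse_sum u m|.
    by rewrite normrM normr_nat.
  move: h1 h2 h3; rewrite -h4.
  move: (p%:R * _) (thue_morse_sum u N) (thue_morse_sum u _) (\sum_(_ <= _ < _) _).
  by move=> *; lia.
move: hrec; rewrite -(ler_int R) !rmorphD rmorphM /= !intr_norm !rmorph_nat.
have powm : N%:R `^ alpha >= m%:R `^ alpha * p%:R.
  rewrite -ap -powRM // -natrM ge0_ler_powR ?nnegrE //.
  by rewrite ler_nat [leqRHS]EN leq_addr.
move: (`|_|) (`|_|) (m%:R `^ _) (N%:R `^ _) powm => x y z w powm h1 h2.
have pR : 2 <= p%:R :> R by rewrite ler_nat.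
have h3 := ler_wpM2l (ler0n R p) h2.
have h4 := ler_wpM2l (ler0n R M.+1) powm.
have h5 := ler_wpM2l (ler0n R M.+1) pR.
rewrite -natr1 in h2 h3 h4 h5 *; nra.
Qed.

(** * From counting to Thue-Morse sums *)

(** The shift by [p.-1 - a] makes the quotient jump exactly at the elements of
the class of [a]. *)
Lemma residue_count (p a N : nat) : prime p -> (a < p)%N ->
  (\sum_(0 <= n < N) (n%:R == a%:R :> 'F_p))%N = ((N + (p.-1 - a)) %/ p)%N.
Proof.
move=> pp ap; have p0 := prime_gt0 pp; elim: N => [|N IH].
  by rewrite big_nil divn_small //; lia.
rewrite big_nat_recr //= IH addSn divnS // addnC; congr (nat_of_bool _ + _)%N.
have -> : ((N + (p.-1 - a)).+1 = N + (p - a))%N by lia.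
rewrite (dvdn_pcharf (pchar_Fp pp)) natrD natrB; last exact: ltnW.
by rewrite pchar_Fp_0 // sub0r subr_eq0.
Qed.

Lemma ceil_nat (R : realType) (x : R) : 0 < x ->
  exists N : nat, [/\ forall n : nat, (n%:R < x) = (n < N)%N, x <= N%:R & N%:R < x + 1].
Proof.
move=> x0.
have ex : exists n : nat, x <= n%:R.
  by exists (Num.bound x); rewrite ltW // archi_boundP // ltW.
case: (ex_minnP ex) => N xN minN; exists N; split=> // [n|].
  apply/idP/idP => [nx|nN]; first by rewrite -(ltr_nat R) (lt_le_trans nx).
  by rewrite ltNge; apply/negP => /minN; rewrite leqNgt nN.
have N0 : (0 < N)%N by rewrite -(ltr_nat R) (lt_le_trans x0).
rewrite -(prednK N0) -natr1 ltrD2r ltNge; apply/negP => /minN.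
by rewrite leqNgt prednK ?leqnn.
Qed.

Lemma digit_parity_countE (R : realType) (p a j N : nat) (x : R) :
  prime p -> (a < p)%N -> (forall n : nat, (n%:R < x) = (n < N)%N) ->
  digit_parity_count p a j x =
  (\sum_(0 <= n < N) ((n%:R == a%:R :> 'F_p) && (binary_ones n == j %[mod 2])))%N.
Proof.
move=> pp ap xN; rewrite /digit_parity_count.
pose P n := (n%:R == a%:R :> 'F_p) && (binary_ones n == j %[mod 2]).
have eqF n : (n%:R == a%:R :> 'F_p) = (n == a %[mod p]).
  by rewrite -val_eqE /= !val_Fp_nat.
rewrite (perm_size (_ : perm_eq _ [seq n <- iota 0 N | P n])).
  rewrite size_filter -sum1_count /index_iota subn0 big_mkcond.
  by apply: eq_bigr => n _; rewrite /P; case: (_ && _).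
apply: uniq_perm; rewrite ?filter_uniq ?iota_uniq ?fset_uniq // => n.
rewrite (in_fset_set (digit_parity_set_finite _ _ _ _)) mem_filter mem_iota add0n.
rewrite -xN /P eqF; apply/idP/idP.
  by rewrite inE => -[-> /eqP-> /eqP->].
by move=> /andP[/andP[/eqP h1 /eqP h2] h3]; rewrite inE; split.
Qed.

(** Detection of a parity by signs: twice the indicator of [s = j] mod 2 is
1 + (-1)^(s+j). *)
Lemma digit_parity_sumM2 (p a j N : nat) :
  ((\sum_(0 <= n < N)
     ((n%:R == a%:R :> 'F_p) && (binary_ones n == j %[mod 2]))) * 2)%N%:R =
  (\sum_(0 <= n < N) (n%:R == a%:R :> 'F_p))%N%:R +
  (-1) ^+ j * thue_morse_sum (a%:R : 'F_p) N.
Proof.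
rewrite mulr_sumr natrM !natr_sum mulr_suml [X in _ + X]big_mkcond -big_split /=.
apply: eq_bigr => n _; case: (n%:R == _) => /=; last by rewrite mul0r addr0.
rewrite /thue_morse -exprD -signr_odd oddD !modn2.
by case: (odd _); case: (odd _).
Qed.

Lemma remainder_thue_morse_sum (R : realType) (p a j : nat) (x : R) :
  prime p -> (a < p)%N -> 0 < x ->
  exists N : nat, [/\ x <= N%:R, N%:R < x + 1 &
    `|2 * `|remainder p a j x| - `|(thue_morse_sum (a%:R : 'F_p) N)%:~R| | <= 2].
Proof.
move=> pp ap x0; have [N [xN xleN Nltx]] := ceil_nat x0.
exists N; split=> //.
rewrite /remainder (digit_parity_countE _ pp ap xN).
have := digit_parity_sumM2 p a j N; rewrite residue_count //.
set T := (\sum_(0 <= _ < _) _)%N; set C := (_ %/ p)%N; set S := thue_morse_sum _ _.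
move=> /(congr1 (intr : int -> R)).
rewrite intrD intrM rmorph_sign !rmorph_nat natrM => TE.
have -> : `|S%:~R| = `|(-1) ^+ j * S%:~R| :> R.
  by rewrite normrM normrX normrN1 expr1n mul1r.
have p0 : 0 < p%:R :> R by rewrite ltr0n prime_gt0.
have Cle : C%:R * p%:R <= N%:R + (p%:R - 1) :> R.
  have := leq_trunc_div (N + (p.-1 - a)) p; rewrite -/C => h.
  have : (C * p + 1 <= N + p)%N by have := prime_gt0 pp; lia.
  by rewrite -(ler_nat R) !natrD natrM; lra.
have Cge : N%:R < C%:R * p%:R + p%:R :> R.
  have := ltn_ceil (N + (p.-1 - a)) (prime_gt0 pp); rewrite -/C => h.
  by rewrite -natrM -natrD ltr_nat; lia.
have E2 : `|2 * `|T%:R - x / (2 * p%:R)| - `|(-1) ^+ j * S%:~R| | <=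
    `|C%:R - x / p%:R|.
  have -> : 2 * `|T%:R - x / (2 * p%:R)| = `|2 * (T%:R - x / (2 * p%:R))|.
    by rewrite normrM ger0_norm.
  apply: le_trans (ler_dist_dist _ _) _; rewrite mulrBr (mulrC 2 T%:R) TE.
  rewrite le_eqVlt; apply/orP; left; apply/eqP; congr (`|_|).
  by field; rewrite gt_eqF.
apply: le_trans E2 _; rewrite ler_norml.
have xE : x / p%:R * p%:R = x by rewrite divfK // gt_eqF.
have p1 : 1 <= p%:R :> R by rewrite ler1n prime_gt0.
apply/andP; split.
  rewrite -(ler_pM2r p0) mulrBl xE; lra.
rewrite -(ler_pM2r p0) mulrBl xE; lra.
Qed.

(** * The exact exponent *)

Lemma remainder_bigO (R : realType) (p a j : nat) (alpha beta : R) :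
  prime p -> odd p -> semiprimitive_root2 p -> (a < p)%N ->
  0 <= alpha -> (2 ^ p.-1)%:R `^ alpha = p%:R -> alpha <= beta ->
  remainder p a j =O_ (+oo_R) (fun x : R => x `^ beta).
Proof.
move=> pp op sp ap a0 aE ab.
pose D : R := (2 ^ p.-1).+1%:R; have D0 : 0 <= D by [].
(* The sum is taken up to N <= x + 1 <= 2 x, which costs the factor 2^beta. *)
apply/eqO_exP; exists (D * 2 `^ beta + 1).
  by rewrite ltr_wpDl // mulr_ge0 // powR_ge0.
exists 1; split; rewrite ?num_real // => x x1.
have x0 : 0 < x by lra.
have [N [xN Nx]] := remainder_thue_morse_sum j pp ap x0.
rewrite ler_norml => /andP[_ h1].
have N0 : (0 < N)%N by rewrite -(ltr_nat R) (lt_le_trans x0).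
have h2 := thue_morse_sum_upper_bound (a%:R : 'F_p) pp op sp a0 aE N0.
rewrite -/D in h2.
have b0 : 0 <= beta by lra.
have h3 : N%:R `^ alpha <= 2 `^ beta * x `^ beta.
  rewrite -powRM ?(ltW x0) //; apply: (@le_trans _ _ (N%:R `^ beta)).
    by rewrite ler_powR // ler1n.
  by rewrite ge0_ler_powR ?nnegrE //; lra.
have h4 : 1 <= x `^ beta by have := ler_powR (ltW x1) b0; rewrite powRr0.
rewrite (ger0_norm (powR_ge0 _ _)).
have h5 := ler_wpM2l D0 h3.
rewrite mulrDl mul1r -mulrA; lra.
Qed.

(** Along x = M^(t+1), where x^alpha = p^(t+1), the remainder is at least
p^t / 2 - 1. *)
Lemma remainder_not_littleo (R : realType) (p a j : nat) (alpha gamma : R) :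
  prime p -> odd p -> semiprimitive_root2 p -> (a < p)%N ->
  (2 ^ p.-1)%:R `^ alpha = p%:R -> gamma <= alpha ->
  ~ (remainder p a j =o_ (+oo_R) (fun x : R => x `^ gamma)).
Proof.
move=> pp op sp ap aE ga /eqoP o.
have p1 := prime_gt1 pp; have pR : 3 <= p%:R :> R by rewrite ler_nat; lia.
(* With this constant the little-o bound at M^(t+1) is p^t / 8, below the lower
   bound p^t / 2 - 1 as soon as p^t >= 3. *)
have c0 : 0 < (8 * p%:R)^-1 :> R by rewrite invr_gt0; lra.
have [A [_ hA]] := o _ c0.
pose M := (2 ^ p.-1)%N; have M1 : (1 < M)%N by rewrite -(expn0 2) ltn_exp2l //; lia.
pose t := (Num.bound `|A|).+1.
have xA : A < ((M ^ t.+1)%N)%:R.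
  apply: (le_lt_trans (ler_norm A)); apply: (lt_trans (archi_boundP (normr_ge0 A))).
  rewrite ltr_nat; apply: (@ltn_trans t.+1); first by rewrite ltnS leqnSn.
  exact: ltn_expl.
have := hA _ xA; rewrite /=.
have x0 : 0 < ((M ^ t.+1)%N)%:R :> R by rewrite ltr0n expn_gt0 (ltnW M1).
have [N [xN Nx]] := remainder_thue_morse_sum j pp ap x0.
have EN : N = (M ^ t.+1)%N.
  move: xN Nx; rewrite natr1 ler_nat ltr_nat ltnS => h1 h2.
  by apply/anti_leq; rewrite h1 h2.
rewrite EN => rS ro.
have lo := thue_morse_sum_lower_bound (a%:R : 'F_p) t pp op sp.
rewrite -/M -(ler_int R) rmorphXn /= rmorph_nat intr_norm in lo.
have gE : ((M ^ t.+1)%N)%:R `^ gamma <= p%:R ^+ t.+1 :> R.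
  apply: (@le_trans _ _ (((M ^ t.+1)%N)%:R `^ alpha)).
    by rewrite ler_powR // ler1n expn_gt0 (ltnW M1).
  by rewrite natrX -powR_mulrn // -powRrM mulrC powRrM aE powR_mulrn.
rewrite (ger0_norm (powR_ge0 _ _)) in ro.
have ro' : `|remainder p a j ((M ^ t.+1)%N)%:R| <= p%:R ^+ t / 8 :> R.
  apply: (le_trans ro); apply: (le_trans (ler_wpM2l (ltW c0) gE)).
  rewrite le_eqVlt; apply/orP; left; apply/eqP; rewrite exprS; field.
  by apply/eqP; lra.
have pt : 3 <= p%:R ^+ t :> R.
  by rewrite (le_trans pR) // -[leLHS]expr1 ler_weXn2l // ; lra.
move: rS; rewrite ler_norml => /andP[h _]; lra.
Qed.

Lemma powR_bigO_littleo (R : realType) (f : R -> R) (a b : R) :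
  a < b -> f =O_ (+oo_R) (fun x : R => x `^ a) ->
  f =o_ (+oo_R) (fun x : R => x `^ b).
Proof.
move=> ab /eqO_exP[k k0 [A [Ar hA]]]; apply/eqoP => e e0.
(* Past the last threshold, x^(b - a) >= k / e. *)
exists (Num.max (Num.max A 0) ((k / e) `^ (b - a)^-1)).
split; first exact: num_real.
move=> x; rewrite !gt_max => /andP[/andP[Ax x0] kx].
apply: (le_trans (hA x Ax)); rewrite !ger0_norm ?powR_ge0 //.
have ba : 0 < b - a by lra.
have -> : b = a + (b - a) by lra.
rewrite powRD; last by rewrite (gt_eqF x0) implybT.
rewrite mulrCA mulrC ler_wpM2l ?powR_ge0 //.
rewrite mulrC -ler_pdivrMr //.
have := @ge0_ler_powR _ (b - a) (ltW ba) ((k / e) `^ (b - a)^-1) x.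
rewrite !nnegrE powR_ge0 => /(_ isT (ltW x0) (ltW kx)).
by rewrite -powRrM mulVf ?gt_eqF // powRr1 // divr_ge0 // ltW.
Qed.

(** If [a < b], the O-bound with an exponent slightly above [a] contradicts the
Omega-bound with an exponent slightly below [b]. *)
Lemma exact_exponent_unique (R : realType) (m : nat) (a b : R) :
  (0 < m)%N -> is_exact_exponent m a -> is_exact_exponent m b -> a = b.
Proof.
move=> m0; wlog ab : a b / a < b.
  by move=> H ha hb; case: (ltgtP a b) => // ab; [apply: H | apply/esym/H].
move=> ha hb; have e0 : 0 < (b - a) / 3 by lra.
have [h _] := ha _ e0 0%N 0%N m0 isT.
have [_ []] := hb _ e0 0%N 0%N m0 isT.
by apply: powR_bigO_littleo h; lra.
Qed.

Lemma sqr_le_exp3 (n : nat) : (2 < n)%N -> (n ^ 2 <= 3 ^ n.-1)%N.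
Proof.
elim: n => // n IH; rewrite ltnS leq_eqVlt => /predU1P[<- //|n2].
have -> : (3 ^ n.+1.-1 = 3 * 3 ^ n.-1)%N by rewrite -expnS prednK //; lia.
have := IH n2; move: (3 ^ _)%N => e; rewrite -!mulnn; nia.
Qed.

Lemma exponent_powR (R : realType) (p : nat) : (1 < p)%N ->
  (2 ^ p.-1)%:R `^ (ln p%:R / ((p%:R - 1) * ln 2)) = p%:R :> R.
Proof.
move=> p1; have l2 : 0 < ln 2 :> R by rewrite ln_gt0 //; lra.
have pr : 1 < p%:R :> R by rewrite ltr1n.
rewrite /powR gt_eqF; last by rewrite ltr0n expn_gt0.
rewrite natrX lnXn // -(mulr_natl (ln 2)) -[in X in _ * (X * _)]subn1 natrB; last exact: ltnW.
rewrite divfK ?lnK ?posrE //; first lra.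
by rewrite gt_eqF // mulr_gt0 //; lra.
Qed.

(** After clearing denominators this is p^2 <= 3^(p-1). *)
Lemma exponent_le (R : realType) (p : nat) : (2 < p)%N ->
  ln p%:R / ((p%:R - 1) * ln 2) <= ln 3 / ln 4 :> R.
Proof.
move=> p2; have p1 := ltnW p2; have l2 : 0 < ln 2 :> R by rewrite ln_gt0 //; lra.
have pr : 1 < p%:R :> R by rewrite ltr1n.
have -> : ln 4 = 2 * ln 2 :> R.
  by rewrite (_ : 4 = 2 ^+ 2) ?lnXn // ?mulr_natl //; rewrite -natrX.
have h : 2 * ln p%:R <= (p%:R - 1) * ln 3 :> R.
  have -> : p%:R - 1 = p.-1%:R :> R by rewrite -subn1 natrB // ltnW.
  rewrite !mulr_natl -!lnXn //; last by lra.
  rewrite ler_ln ?posrE -?natrX ?ltr0n ?expn_gt0 //; last by rewrite ltnW.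
  by rewrite ler_nat sqr_le_exp3.
rewrite ler_pdivrMr; last by rewrite mulr_gt0 //; lra.
have -> : ln 3 / (2 * ln 2) * ((p%:R - 1) * ln 2) = (p%:R - 1) * ln 3 / 2 :> R.
  by field; rewrite gt_eqF.
lra.
Qed.

Theorem theorem3 (R : realType) (p : nat) :
  prime p -> odd p -> semiprimitive_root2 p ->
  (forall a j : nat, (a < p)%N -> (j < 2)%N ->
     remainder p a j =O_ (+oo_R) (fun x : R => x `^ (ln 3 / ln 4))) /\
  (forall alpha : R, is_exact_exponent p alpha <->
     alpha = ln p%:R / ((p%:R - 1) * ln 2)).
Proof.
move=> pp op sp; have p1 := prime_gt1 pp.
set alpha0 : R := ln p%:R / _; have aE : _ `^ alpha0 = _ := exponent_powR R p1.
have a0 : 0 <= alpha0.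
  have pr : 1 < p%:R :> R by rewrite ltr1n.
  rewrite divr_ge0 ?ln_ge0 ?mulr_ge0 ?ln_ge0 //; lra.
split=> [a j ap _|alpha].
  exact: remainder_bigO pp op sp ap a0 aE (exponent_le R (odd_prime_gt2 op pp)).
have ex : is_exact_exponent p alpha0.
  move=> eps e0 a j ap _; split.
    by apply: (remainder_bigO _ pp op sp ap a0 aE); lra.
  by apply: (remainder_not_littleo pp op sp ap aE); lra.
split=> [h|->//]; exact: exact_exponent_unique (prime_gt0 pp) h ex.
Qed.
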